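(* Let $p>0$, let $a,f\in C(\mathbb{R})$ satisfy $a(t+p)=a(t)$ and $f(t+p)=f(t)$ for all $t$, and let $g\in C^1(\mathbb{R})$. Assume that $$\int_0^p a(t)\,dt=0,$$ and that the (finite) limits $g(\infty)=\lim_{x\to\infty}g(x)$ and $g(-\infty)=\lim_{x\to-\infty}g(x)$ exist and $$g(-\infty)<g(x)<g(\infty)\quad\text{for all } x\in\mathbb{R}.$$ Let $\mu(t)=e^{\int_0^t a(s)\,ds}$. Consider the equation $$x'+a(t)x+g(x)=f(t) \qquad ( * )$$ and the condition $$g(-\infty)\int_0^p\mu(t)\,dt<\int_0^p\mu(t)f(t)\,dt<g(\infty)\int_0^p\mu(t)\,dt. \qquad ( ** )$$ Then: (1) Equation $( * )$ has a $p$-periodic solution if and only if $f$ satisfies $( ** )$. (2) If $( ** )$ holds and in addition $g'(x)>0$ for all $x\in\mathbb{R}$, then $( * )$ has a unique $p$-periodic solution, and it attracts all other solutions of $( * )$ as $t\to\infty$. (3) If $( ** )$ fails, then all solutions of $( * )$ are unbounded as $t\to\infty$ and as $t\to-\infty$.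
   Context: A solution $x(t)$ is unbounded as $t\to\infty$ (respectively $t\to-\infty$) if $|x(t)|$ is unbounded on $[0,\infty)$ (respectively on $(-\infty,0]$). A periodic solution $y(t)$ attracts a solution $x(t)$ as $t\to\infty$ if $x(t)-y(t)\to0$ as $t\to\infty$. *)

(* Defs.v *)
From Stdlib Require Import Reals.
From Coquelicot Require Import Coquelicot.
Open Scope R_scope.

(* [p] is a period, not necessarily the least one. *)
Definition periodic (p : R) (h : R -> R) : Prop :=
  forall t : R, h (t + p) = h t.

Definition class_C0 (h : R -> R) : Prop :=
  forall t : R, continuous h t.

(* [Derive] is total, so differentiability is required separately. *)
Definition class_C1 (h : R -> R) : Prop :=
  (forall x : R, ex_derive h x) /\ class_C0 (Derive h).

Definition mu (a : R -> R) (t : R) : R := exp (RInt a 0 t).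

(* x' + a(t) x + g(x) = f(t) on the whole line. *)
Definition is_solution (a f g x : R -> R) : Prop :=
  forall t : R,
    ex_derive x t /\ Derive x t + a t * x t + g (x t) = f t.

Definition is_periodic_solution (p : R) (a f g x : R -> R) : Prop :=
  is_solution a f g x /\ periodic p x.

(* [gm] and [gp] stand for g(-oo) and g(+oo). *)
Definition solvability_condition (p : R) (a f : R -> R) (gm gp : R) : Prop :=
  gm * RInt (mu a) 0 p < RInt (fun t => mu a t * f t) 0 p /\
  RInt (fun t => mu a t * f t) 0 p < gp * RInt (mu a) 0 p.

Definition attracts (y x : R -> R) : Prop :=
  is_lim (fun t => x t - y t) p_infty 0.

Definition unbounded_pinfty (x : R -> R) : Prop :=
  ~ (exists M : R, forall t : R, 0 <= t -> Rabs (x t) <= M).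

Definition unbounded_minfty (x : R -> R) : Prop :=
  ~ (exists M : R, forall t : R, t <= 0 -> Rabs (x t) <= M).

(* Main.v *)
Require Import Defs.
From Stdlib Require Import Reals ZArith Lra Lia.
From Coquelicot Require Import Coquelicot.
Open Scope R_scope.

(** Since [a] has mean zero, [mu a] is [p]-periodic and lies between two
    positive constants, and the substitution [u = mu a * x] turns the equation
    into [u' = mu a (f - g (u / mu a))], in which only the bounded terms are
    left.  Write [J] and [If] for the integrals of [mu a] and [mu a * f] over
    one period.  Integrating over a period,
    [u (t + p) - u t = If - int mu a * g(x)], so everything is decided by the
    comparison of [g(x)] with constants ([period_increment]).

    Unboundedness.  Suppose that [If >= gp J].  On a bounded set [g] stays below
    [gp] by some fixed [d > 0], so a solution bounded on a half-line would have
    [u (t + p) - u t >= d J] there; then [u] grows linearly, against boundedness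
    ([unbounded_solutions]).  The case [If <= gm J] is the same with signs
    reversed.  As a periodic solution is bounded, this also shows that the
    condition is necessary for a periodic solution.

    Existence.  Under the condition, the weighted mean [c = If / J] of [f] lies
    strictly between [gm] and [gp], so [g >= c] far to the right and [g <= c] far
    to the left.  Because [u'] is bounded, an orbit starting far enough to the
    right keeps [g(x) >= c] during the whole period, so it does not advance;
    symmetrically on the left.  The period map thus sends the ends of an interval
    inwards, and it is nondecreasing because orbits do not cross; a
    nondecreasing map of this kind has a fixed point ([periodic_orbit]).
    To have global Lipschitz flows, [g] is first frozen outside an interval that
    the periodic orbit turns out never to leave ([exists_periodic_solution]).

    Attraction.  If [g' > 0], the square of [mu a (x - y)] has a nonpositive
    derivative for any two solutions.  Hence, forwards in time, every
    solution stays within bounded distance of the periodic one; on the resulting bounded range [g'] has a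
    positive lower bound [m], and the same computation gives the decay
    [exp (- m t)] ([periodic_solution_attracts]).  Two periodic functions
    that approach each other are equal, which gives uniqueness. *)

(** * Monotonicity, periodicity and boundedness *)

Lemma le_of_derive_nonneg (h dh : R -> R) (s t : R) :
  s <= t ->
  (forall r, s <= r <= t -> is_derive h r (dh r)) ->
  (forall r, s <= r <= t -> 0 <= dh r) ->
  h s <= h t.
Proof.
  intros Hst Hd Hpos.
  destruct (MVT_gen h s t dh) as [r [Hr Heq]].
  - intros r Hr; rewrite Rmin_left, Rmax_right in Hr by lra; apply Hd; lra.
  - intros r Hr; rewrite Rmin_left, Rmax_right in Hr by lra.
    apply continuity_pt_filterlim, (ex_derive_continuous h).
    exists (dh r); apply Hd; lra.
  - rewrite Rmin_left, Rmax_right in Hr by lra.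
    assert (0 <= dh r * (t - s)) by (apply Rmult_le_pos; [apply Hpos; lra | lra]).
    lra.
Qed.

Lemma is_derive_RInt0 (h : R -> R) (t : R) :
  class_C0 h -> is_derive (fun s => RInt h 0 s) t (h t).
Proof.
  intros Hh; apply is_derive_RInt with 0.
  - apply filter_forall; intros s; apply RInt_correct, ex_RInt_continuous.
    intros z _; apply Hh.
  - apply Hh.
Qed.

Lemma periodic_reduce (p t : R) :
  0 < p -> exists (k : Z) (s : R), 0 <= s <= p /\ t = s + IZR k * p.
Proof.
  intros Hp.
  destruct (archimed (t / p)) as [H1 H2].
  exists (up (t / p) - 1)%Z, (t - IZR (up (t / p) - 1) * p).
  rewrite minus_IZR.
  assert (t = t / p * p) by (field; lra).
  split; [|ring].
  split; nra.
Qed.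

Lemma periodic_IZR (p : R) (h : R -> R) (k : Z) (t : R) :
  periodic p h -> h (t + IZR k * p) = h t.
Proof.
  intros Hper.
  assert (Hn : forall (n : nat) s, h (s + INR n * p) = h s).
  { induction n as [|n IH]; intros s; [simpl; f_equal; ring|].
    rewrite S_INR, <- (IH s), <- (Hper (s + INR n * p)); f_equal; ring. }
  destruct (Z_le_gt_dec 0 k) as [Hk|Hk].
  - rewrite <- (Z2Nat.id k Hk), <- INR_IZR_INZ; apply Hn.
  - rewrite <- (Hn (Z.to_nat (- k)) (t + IZR k * p)); f_equal.
    rewrite INR_IZR_INZ, Z2Nat.id, opp_IZR by lia; ring.
Qed.

Lemma continuous_attains_max (h : R -> R) (s t : R) :
  s <= t -> class_C0 h ->
  exists r, s <= r <= t /\ forall q, s <= q <= t -> h q <= h r.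
Proof.
  intros Hst Hh.
  destruct (continuity_ab_maj h s t Hst) as [r [H1 H2]].
  - intros r _; apply continuity_pt_filterlim, Hh.
  - exists r; split; [exact H2 | exact H1].
Qed.

Lemma class_C0_opp (h : R -> R) : class_C0 h -> class_C0 (fun t => - h t).
Proof. intros Hh t; apply (continuous_opp h), Hh. Qed.

Lemma class_C0_mult (h k : R -> R) :
  class_C0 h -> class_C0 k -> class_C0 (fun t => h t * k t).
Proof. intros Hh Hk t; apply (continuous_mult h k); auto. Qed.

Lemma continuous_bounded_segment (h : R -> R) (s t : R) :
  s <= t -> class_C0 h ->
  exists M, 0 < M /\ forall q, s <= q <= t -> Rabs (h q) <= M.
Proof.
  intros Hst Hh.
  destruct (continuous_attains_max h s t Hst Hh) as [r [_ Hr]].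
  destruct (continuous_attains_max _ s t Hst (class_C0_opp h Hh)) as [r' [_ Hr']].
  exists (Rabs (h r) + Rabs (h r') + 1); split.
  - pose proof (Rabs_pos (h r)); pose proof (Rabs_pos (h r')); lra.
  - intros q Hq; specialize (Hr q Hq); specialize (Hr' q Hq).
    pose proof (Rle_abs (h r)); pose proof (Rabs_maj2 (h r')).
    pose proof (Rabs_pos (h r)); pose proof (Rabs_pos (h r')).
    apply Rabs_le; lra.
Qed.

Lemma periodic_bounded (p : R) (h : R -> R) :
  0 < p -> class_C0 h -> periodic p h ->
  exists M, 0 < M /\ forall t, Rabs (h t) <= M.
Proof.
  intros Hp Hh Hper.
  destruct (continuous_bounded_segment h 0 p) as [M [HM HMb]]; [lra | exact Hh |].
  exists M; split; [exact HM|]; intros t.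
  destruct (periodic_reduce p t Hp) as [k [s [Hs ->]]].
  rewrite periodic_IZR by exact Hper; apply HMb, Hs.
Qed.

Lemma RInt0_periodic_shift (p : R) (h : R -> R) (t : R) :
  class_C0 h -> periodic p h ->
  RInt h 0 (t + p) = RInt h 0 t + RInt h 0 p.
Proof.
  intros Hh Hper.
  rewrite <- (RInt_Chasles h 0 p (t + p));
    [| apply ex_RInt_continuous; intros; apply Hh
     | apply ex_RInt_continuous; intros; apply Hh].
  rewrite Rplus_comm; change plus with Rplus; f_equal.
  pose proof (RInt_comp_lin h 1 p 0 t) as Hcomp.
  replace (1 * 0 + p) with p in Hcomp by ring.
  replace (1 * t + p) with (t + p) in Hcomp by ring.
  rewrite <- Hcomp by (apply ex_RInt_continuous; intros; apply Hh).
  apply RInt_ext; intros s _; unfold scal; simpl; unfold mult; simpl.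
  rewrite !Rmult_1_l; apply Hper.
Qed.

(** * Global flows of bounded Lipschitz equations *)

(** With [K * exp (c * t)] as bound for the derivative, integrating gains the
    factor [1 / c]: this is what makes the integral operator a contraction in an
    exponentially weighted norm, on the whole line at once. *)
Lemma exp_bound_pos (d d' : R -> R) (K c t : R) :
  0 < c -> 0 <= t -> 0 <= K -> d 0 = 0 ->
  (forall s, is_derive d s (d' s)) ->
  (forall s, 0 <= s -> Rabs (d' s) <= K * exp (c * s)) ->
  Rabs (d t) <= K / c * exp (c * t).
Proof.
  intros Hc Ht HK Hd0 Hd Hb.
  assert (HKc : 0 <= K / c)
    by (apply Rmult_le_pos; [lra | apply Rlt_le, Rinv_0_lt_compat, Hc]).
  assert (Hs : forall e, Rabs e <= 1 -> e * d t <= K / c * exp (c * t)).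
  { intros e He.
    assert (H : K / c * exp (c * 0) - e * d 0 <= K / c * exp (c * t) - e * d t).
    { apply (le_of_derive_nonneg (fun s => K / c * exp (c * s) - e * d s)
               (fun s => K * exp (c * s) - e * d' s) 0 t Ht).
      - intros s _. pose proof (Hd s) as Hds.
        auto_derive; [exists (d' s); exact Hds |].
        replace (Derive (fun x : R => d x) s) with (d' s)
          by (symmetry; apply is_derive_unique, Hds).
        field; lra.
      - intros s [Hs _]; specialize (Hb s Hs).
        pose proof (Rle_abs (e * d' s)) as H1; rewrite Rabs_mult in H1.
        pose proof (Rabs_pos (d' s)); nra. }
    rewrite Hd0, Rmult_0_r, exp_0 in H; lra. }
  apply Rabs_le; split.
  - specialize (Hs (-1)); rewrite Rabs_left in Hs by lra; lra.
  - specialize (Hs 1); rewrite Rabs_R1 in Hs; lra.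
Qed.

Lemma exp_bound_abs (d d' : R -> R) (K c t : R) :
  0 < c -> 0 <= K -> d 0 = 0 ->
  (forall s, is_derive d s (d' s)) ->
  (forall s, Rabs (d' s) <= K * exp (c * Rabs s)) ->
  Rabs (d t) <= K / c * exp (c * Rabs t).
Proof.
  intros Hc HK Hd0 Hd Hb.
  destruct (Rle_or_lt 0 t) as [Ht|Ht].
  - rewrite (Rabs_pos_eq t Ht).
    apply exp_bound_pos with d'; auto.
    intros s Hs; specialize (Hb s); rewrite (Rabs_pos_eq s Hs) in Hb; exact Hb.
  - rewrite (Rabs_left t Ht).
    replace (d t) with (d (- - t)) by (f_equal; ring).
    apply (exp_bound_pos (fun s => d (- s)) (fun s => - d' (- s)) K c (- t)); auto.
    + lra.
    + rewrite Ropp_0; exact Hd0.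
    + intros s; pose proof (Hd (- s)) as Hds.
      auto_derive; [exists (d' (- s)); exact Hds |].
      replace (Derive (fun x : R => d x) (- s)) with (d' (- s))
        by (symmetry; apply is_derive_unique, Hds).
      ring.
    + intros s Hs; specialize (Hb (- s)).
      rewrite Rabs_Ropp, (Rabs_pos_eq s Hs) in Hb.
      rewrite Rabs_Ropp; exact Hb.
Qed.

(** The limit is named by the total operator [Lim_seq], so that the limits of a
    sequence of functions form a function without a choice principle. *)
Lemma geometric_increments_converge (v : nat -> R) (K : R) :
  0 <= K -> (forall n, Rabs (v (S n) - v n) <= K / 2 ^ n) ->
  forall n, Rabs (v n - real (Lim_seq v)) <= 2 * K / 2 ^ n.
Proof.
  intros HK Hinc.
  assert (Hp2 : forall n, 0 < 2 ^ n) by (intros; apply pow_lt; lra).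
  assert (Htail : forall n k, Rabs (v (n + k)%nat - v n) <= 2 * K / 2 ^ n * (1 - / 2 ^ k)).
  { intros n k; induction k as [|k IH].
    - rewrite Nat.add_0_r, Rminus_diag, Rabs_R0; simpl; lra.
    - rewrite Nat.add_succ_r.
      replace (v (S (n + k)) - v n)
        with ((v (S (n + k)) - v (n + k)%nat) + (v (n + k)%nat - v n)) by ring.
      eapply Rle_trans; [apply Rabs_triang|].
      eapply Rle_trans; [apply Rplus_le_compat; [apply Hinc | apply IH] |].
      rewrite pow_add; simpl.
      pose proof (Hp2 n); pose proof (Hp2 k).
      apply Req_le; field; lra. }
  assert (Htail' : forall n m, (n <= m)%nat -> Rabs (v m - v n) <= 2 * K / 2 ^ n).
  { intros n m Hnm.
    replace m with (n + (m - n))%nat by lia.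
    eapply Rle_trans; [apply Htail|].
    rewrite <- (Rmult_1_r (2 * K / 2 ^ n)) at 2.
    apply Rmult_le_compat_l.
    - pose proof (Hp2 n); apply Rmult_le_pos; [lra | apply Rlt_le, Rinv_0_lt_compat; lra].
    - pose proof (Rinv_0_lt_compat _ (Hp2 (m - n)%nat)); lra. }
  assert (Hgeo : is_lim_seq (fun n => 2 * K / 2 ^ n) 0).
  { apply is_lim_seq_ext with (fun n => 2 * K * (/ 2) ^ n).
    - intros n; rewrite pow_inv; reflexivity.
    - replace (Finite 0) with (Rbar_mult (2 * K) 0) by (simpl; f_equal; ring).
      apply is_lim_seq_scal_l, is_lim_seq_geom.
      rewrite Rabs_pos_eq; lra. }
  assert (Hlim : is_lim_seq v (real (Lim_seq v))).
  { apply Lim_seq_correct'. apply ex_lim_seq_cauchy_corr.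
    intros eps.
    apply is_lim_seq_spec in Hgeo.
    destruct (Hgeo (mkposreal (eps / 2) ltac:(destruct eps; simpl; lra))) as [N HN].
    exists N; intros n m Hn Hm.
    specialize (HN N (Nat.le_refl N)); simpl in HN.
    rewrite Rminus_0_r in HN; apply Rabs_def2 in HN.
    replace (v n - v m) with ((v n - v N) - (v m - v N)) by ring.
    eapply Rle_lt_trans; [apply Rabs_triang|].
    rewrite Rabs_Ropp.
    pose proof (Htail' N n Hn); pose proof (Htail' N m Hm); lra. }
  intros n.
  rewrite Rabs_minus_sym.
  apply (is_lim_seq_le_loc (fun m => Rabs (v m - v n)) (fun _ => 2 * K / 2 ^ n)
           (Finite (Rabs (real (Lim_seq v) - v n))) (Finite (2 * K / 2 ^ n))).
  - exists n; intros m Hm; apply Htail', Hm.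
  - apply (is_lim_seq_abs _ (Finite (real (Lim_seq v) - v n))).
    apply is_lim_seq_minus'; [exact Hlim | apply is_lim_seq_const].
  - apply is_lim_seq_const.
Qed.

Lemma continuous_of_lipschitz (u : R -> R) (B : R) :
  (forall s t, Rabs (u t - u s) <= B * Rabs (t - s)) -> class_C0 u.
Proof.
  intros Hlip t.
  apply continuity_pt_filterlim.
  assert (HB : 0 <= B).
  { specialize (Hlip 0 1); rewrite Rminus_0_r, Rabs_R1 in Hlip.
    pose proof (Rabs_pos (u 1 - u 0)); lra. }
  intros eps Heps; exists (eps / (B + 1)); split.
  - apply Rdiv_lt_0_compat; lra.
  - intros s [_ Hs]; simpl in *; unfold Rdist in *.
    eapply Rle_lt_trans; [apply Hlip|].
    apply Rle_lt_trans with ((B + 1) * Rabs (s - t)).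
    + pose proof (Rabs_pos (s - t)); nra.
    + replace eps with ((B + 1) * (eps / (B + 1))) by (field; lra).
      apply Rmult_lt_compat_l; lra.
Qed.

Lemma le_of_geometric (x y C : R) :
  (forall n, x <= y + C / 2 ^ n) -> x <= y.
Proof.
  intros H.
  apply (is_lim_seq_le (fun _ => x) (fun n => y + C * (/ 2) ^ n) (Finite x) (Finite y)).
  - intros n; rewrite pow_inv; apply H.
  - apply is_lim_seq_const.
  - replace (Finite y) with (Finite (y + C * 0)) by (f_equal; ring).
    apply (is_lim_seq_plus' (fun _ => y)); [apply is_lim_seq_const|].
    apply (is_lim_seq_scal_l (fun n => (/ 2) ^ n) C (Finite 0)), is_lim_seq_geom.
    rewrite Rabs_pos_eq; lra.
Qed.

Definition integral_curve (F : R -> R -> R) (u : R -> R) : Prop :=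
  forall t, is_derive u t (F t (u t)).

Fixpoint picard (F : R -> R -> R) (u0 : R) (n : nat) (t : R) : R :=
  match n with
  | O => u0
  | S n => u0 + RInt (fun s => F s (picard F u0 n s)) 0 t
  end.

(** In the norm [sup_t |u t| * exp (- 2 L |t|)] the Picard operator contracts by
    [1 / 2], so the iterates converge at a geometric rate at each time.  They all
    are [B]-Lipschitz; hence so is their pointwise limit, which is therefore
    continuous and a fixed point of the operator.  Continuity
    of [F] is asked along continuous curves, the form in which the integrand of
    the operator uses it. *)
Theorem picard_lindelof (F : R -> R -> R) (L B u0 : R) :
  0 < L ->
  (forall u, class_C0 u -> class_C0 (fun s => F s (u s))) ->
  (forall t x y, Rabs (F t x - F t y) <= L * Rabs (x - y)) ->
  (forall t x, Rabs (F t x) <= B) ->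
  exists u, u 0 = u0 /\ integral_curve F u.
Proof.
  intros HL HFc HFl HFb.
  set (U := picard F u0).
  set (I := fun v t => u0 + RInt (fun s => F s (v s)) 0 t).
  assert (HI' : forall v, class_C0 v -> forall t, is_derive (I v) t (F t (v t))).
  { intros v Hv t.
    rewrite <- (Rplus_0_l (F t (v t))).
    apply (is_derive_plus (fun _ => u0)); [apply (is_derive_const u0)|].
    apply (is_derive_RInt0 (fun s => F s (v s)) t (HFc v Hv)). }
  assert (HI0 : forall v, I v 0 = u0).
  { intros v; unfold I; rewrite RInt_point; unfold zero; simpl; ring. }
  assert (HUc : forall n, class_C0 (U n)).
  { induction n as [|n IH]; intros t.
    - apply continuous_const.
    - apply (ex_derive_continuous (I (U n))); eexists; apply HI', IH. }
  assert (HB : 0 <= B) by (eapply Rle_trans; [apply Rabs_pos | apply (HFb 0 0)]).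
  (* [C] bounds the distance of the first two iterates in the weighted norm. *)
  set (C := B / (2 * L)).
  assert (HC : 0 <= C)
    by (apply Rmult_le_pos; [exact HB | apply Rlt_le, Rinv_0_lt_compat; lra]).
  assert (Hpow : forall n, 0 < 2 ^ n) by (intros; apply pow_lt; lra).
  assert (Hcontr : forall v w K, class_C0 v -> class_C0 w -> 0 <= K ->
      (forall t, Rabs (v t - w t) <= K * exp (2 * L * Rabs t)) ->
      forall t, Rabs (I v t - I w t) <= K / 2 * exp (2 * L * Rabs t)).
  { intros v w K Hv Hw HK Hvw t.
    replace (K / 2) with (L * K / (2 * L)) by (field; lra).
    apply (exp_bound_abs (fun t => I v t - I w t) (fun t => F t (v t) - F t (w t))).
    - lra.
    - nra.
    - rewrite !HI0; ring.
    - intros s. apply (is_derive_minus (I v) (I w)); apply HI'; assumption.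
    - intros s; eapply Rle_trans; [apply HFl|].
      rewrite Rmult_assoc; apply Rmult_le_compat_l; [lra | apply Hvw]. }
  assert (Hinc : forall n t,
      Rabs (U (S n) t - U n t) <= C * exp (2 * L * Rabs t) / 2 ^ n).
  { induction n as [|n IH]; intros t.
    - replace (C * exp (2 * L * Rabs t) / 2 ^ 0) with (C * exp (2 * L * Rabs t))
        by (simpl; field).
      apply (exp_bound_abs (fun t => I (U O) t - u0) (fun t => F t u0)).
      + lra.
      + exact HB.
      + rewrite HI0; ring.
      + intros s; rewrite <- (Rminus_0_r (F s u0)).
        apply (is_derive_minus (I (U O)) (fun _ => u0));
          [apply HI', HUc | apply (is_derive_const u0)].
      + intros s; eapply Rle_trans; [apply HFb|].
        pose proof (exp_ineq1_le (2 * L * Rabs s)).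
        assert (0 <= 2 * L * Rabs s) by (pose proof (Rabs_pos s); nra).
        nra.
    - replace (C * exp (2 * L * Rabs t) / 2 ^ S n)
        with (C / 2 ^ n / 2 * exp (2 * L * Rabs t))
        by (simpl; field; pose proof (Hpow n); lra).
      apply (Hcontr (U (S n)) (U n)); try apply HUc.
      + apply Rmult_le_pos; [exact HC | apply Rlt_le, Rinv_0_lt_compat, Hpow].
      + intros s; eapply Rle_trans; [apply IH|].
        apply Req_le; field; pose proof (Hpow n); lra. }
  set (u := fun t => real (Lim_seq (fun n => U n t))).
  assert (Hu : forall n t,
      Rabs (U n t - u t) <= 2 * (C * exp (2 * L * Rabs t)) / 2 ^ n).
  { intros n t; apply (geometric_increments_converge (fun n => U n t)).
    - pose proof (exp_pos (2 * L * Rabs t)); nra.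
    - intros m; apply Hinc. }
  assert (HUlip : forall n s t, Rabs (U n t - U n s) <= B * Rabs (t - s)).
  { intros n s t; destruct n as [|n].
    - unfold U; simpl; rewrite Rminus_diag, Rabs_R0.
      apply Rmult_le_pos; [exact HB | apply Rabs_pos].
    - change (U (S n)) with (I (U n)).
      destruct (MVT_gen (I (U n)) s t (fun t => F t (U n t))) as [r [_ Hr]].
      + intros r _; apply HI', HUc.
      + intros r _; apply continuity_pt_filterlim, (ex_derive_continuous (I (U n))).
        eexists; apply HI', HUc.
      + rewrite Hr, Rabs_mult; apply Rmult_le_compat_r; [apply Rabs_pos | apply HFb]. }
  assert (Huc : class_C0 u).
  { apply continuous_of_lipschitz with B; intros s t.
    apply le_of_geometric with
      (2 * (C * exp (2 * L * Rabs t)) + 2 * (C * exp (2 * L * Rabs s))).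
    intros n; pose proof (Hu n t) as Ht; pose proof (Hu n s) as Hs.
    pose proof (HUlip n s t) as Hl.
    rewrite Rdiv_plus_distr.
    replace (u t - u s) with ((U n t - U n s) - (U n t - u t) + (U n s - u s)) by ring.
    pose proof (Rabs_triang ((U n t - U n s) - (U n t - u t)) (U n s - u s)).
    pose proof (Rabs_triang (U n t - U n s) (- (U n t - u t))) as H'.
    rewrite Rabs_Ropp in H'; unfold Rminus in *; lra. }
  assert (Hfix : forall t, u t = I u t).
  { intros t.
    set (E := C * exp (2 * L * Rabs t)).
    assert (H : Rabs (u t - I u t) <= 0).
    { apply le_of_geometric with (2 * E); intros n; rewrite Rplus_0_l.
      pose proof (Hu (S n) t) as H1.
      assert (H2 : Rabs (I (U n) t - I u t) <= 2 * C / 2 ^ n / 2 * exp (2 * L * Rabs t)).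
      { apply Hcontr; [apply HUc | exact Huc | |].
        - apply Rmult_le_pos; [lra | apply Rlt_le, Rinv_0_lt_compat, Hpow].
        - intros s; eapply Rle_trans; [apply Hu|].
          apply Req_le; field; pose proof (Hpow n); lra. }
      change (U (S n)) with (I (U n)) in H1.
      replace (u t - I u t) with (- (I (U n) t - u t) + (I (U n) t - I u t)) by ring.
      eapply Rle_trans; [apply Rabs_triang|]; rewrite Rabs_Ropp.
      eapply Rle_trans; [apply Rplus_le_compat; [apply H1 | apply H2]|].
      apply Req_le; unfold E; simpl; field; pose proof (Hpow n); lra. }
    apply Rabs_le_between in H; lra. }
  exists u; split.
  - rewrite Hfix; apply HI0.
  - intros t; apply is_derive_ext with (I u); [intros s; symmetry; apply Hfix|].
    apply HI', Huc.
Qed.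

(** Gronwall: for the difference [w] of two curves, [|w w'| <= L w^2], so
    [w^2 exp (- 2 L t)] decreases and [w^2 exp (2 L t)] increases; the first
    carries [w = 0] forwards in time and the second backwards. *)
Lemma ode_unique (F : R -> R -> R) (L : R) (u v : R -> R) (t0 : R) :
  (forall t x y, Rabs (F t x - F t y) <= L * Rabs (x - y)) ->
  integral_curve F u ->
  integral_curve F v ->
  u t0 = v t0 -> forall t, u t = v t.
Proof.
  intros HFl Hu Hv H0 t.
  set (w := fun s => u s - v s).
  set (w' := fun s => F s (u s) - F s (v s)).
  assert (Hw : forall s, is_derive w s (w' s)).
  { intros s; apply (is_derive_minus u v); auto. }
  assert (Hw2 : forall s, Rabs (w s * w' s) <= L * w s ^ 2).
  { intros s; rewrite Rabs_mult, <- pow2_abs.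
    pose proof (HFl s (u s) (v s)); pose proof (Rabs_pos (w s)).
    change (u s - v s) with (w s) in *; change (F s (u s) - F s (v s)) with (w' s) in *.
    nra. }
  assert (Hd : forall c s, is_derive (fun s => w s ^ 2 * exp (c * s)) s
                 ((2 * (w s * w' s) + c * w s ^ 2) * exp (c * s))).
  { intros c s; pose proof (Hw s) as Hws.
    auto_derive; [exists (w' s); exact Hws|].
    replace (Derive (fun x : R => w x) s) with (w' s)
      by (symmetry; apply is_derive_unique, Hws).
    ring. }
  assert (Hz : w t0 = 0) by (unfold w; lra).
  assert (Hsq : w t ^ 2 <= 0).
  { destruct (Rle_or_lt t0 t) as [Ht|Ht].
    - assert (H : - (w t0 ^ 2 * exp (- (2 * L) * t0)) <= - (w t ^ 2 * exp (- (2 * L) * t))).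
      { apply (le_of_derive_nonneg (fun s => - (w s ^ 2 * exp (- (2 * L) * s)))
          (fun s => - ((2 * (w s * w' s) + - (2 * L) * w s ^ 2) * exp (- (2 * L) * s))) t0 t Ht).
        - intros s _; apply (is_derive_opp _ _ _ (Hd (- (2 * L)) s)).
        - intros s _; pose proof (Hw2 s) as H; apply Rabs_le_between in H.
          pose proof (exp_pos (- (2 * L) * s)); nra. }
      rewrite Hz in H; pose proof (exp_pos (- (2 * L) * t)).
      apply Rnot_lt_le; intros Hlt; nra.
    - assert (H : w t ^ 2 * exp (2 * L * t) <= w t0 ^ 2 * exp (2 * L * t0)).
      { apply (le_of_derive_nonneg _ _ t t0 (Rlt_le _ _ Ht) (fun s _ => Hd (2 * L) s)).
        intros s _; pose proof (Hw2 s) as H; apply Rabs_le_between in H.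
        pose proof (exp_pos (2 * L * s)); nra. }
      rewrite Hz in H; pose proof (exp_pos (2 * L * t)).
      apply Rnot_lt_le; intros Hlt; nra. }
  assert (w t = 0) by nra.
  unfold w in *; lra.
Qed.

(** Curves that change order would meet, and then coincide. *)
Lemma ode_order (F : R -> R -> R) (L : R) (u v : R -> R) (s t : R) :
  (forall t x y, Rabs (F t x - F t y) <= L * Rabs (x - y)) ->
  integral_curve F u ->
  integral_curve F v ->
  u s <= v s -> s <= t -> u t <= v t.
Proof.
  intros HFl Hu Hv H0 Hst.
  destruct (Rle_or_lt (u t) (v t)) as [H|H]; [exact H|].
  destruct (IVT_gen (fun r => u r - v r) s t 0) as [r [_ Hr]].
  - intros r; apply continuity_pt_filterlim, (ex_derive_continuous (fun r => u r - v r)).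
    eexists; apply (is_derive_minus u v); [apply Hu | apply Hv].
  - rewrite Rmin_left, Rmax_right by lra; lra.
  - rewrite (ode_unique F L u v r HFl Hu Hv); [lra | lra].
Qed.

(** The hypotheses on [lo] and [hi] say that the period map [P : u 0 |-> u p]
    sends both ends of the interval inwards.  As [P] is nondecreasing, the
    supremum [c] of the points with [r <= P r] satisfies [c <= P c], whence
    [P c <= P (P c)] and so [P c <= c].  This is Tarski's argument: order takes the
    place of the continuity of [P], that is, of continuous dependence on
    initial values. *)
Lemma periodic_orbit (F : R -> R -> R) (L B p lo hi : R) :
  0 < L -> 0 <= p -> lo <= hi ->
  (forall u, class_C0 u -> class_C0 (fun s => F s (u s))) ->
  (forall t x y, Rabs (F t x - F t y) <= L * Rabs (x - y)) ->
  (forall t x, Rabs (F t x) <= B) ->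
  (forall t x, F (t + p) x = F t x) ->
  (forall u, integral_curve F u -> u 0 = lo -> lo <= u p) ->
  (forall u, integral_curve F u -> u 0 = hi -> u p <= hi) ->
  exists u, integral_curve F u /\ periodic p u /\
            lo <= u 0 <= hi.
Proof.
  intros HL Hp Hlohi HFc HFl HFb HFp Hlo Hhi.
  assert (Hex : forall c, exists u, u 0 = c /\ integral_curve F u)
    by (intros c; apply picard_lindelof with L B; assumption).
  assert (Hmono : forall u v, integral_curve F u ->
            integral_curve F v -> u 0 <= v 0 -> u p <= v p)
    by (intros u v Hu Hv H; apply (ode_order F L u v 0 p); assumption).
  set (S := fun c => c <= hi /\ exists u, integral_curve F u /\
                       u 0 = c /\ c <= u p).
  destruct (completeness S) as [c [Hub Hlub]].
  { exists hi; intros r [Hr _]; exact Hr. }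
  { exists lo; split; [exact Hlohi|].
    destruct (Hex lo) as [u [Hu0 Hu]]; exists u; split; auto. }
  assert (Hc : lo <= c <= hi).
  { split.
    - apply Hub; split; [exact Hlohi|].
      destruct (Hex lo) as [u [Hu0 Hu]]; exists u; split; auto.
    - apply Hlub; intros r [Hr _]; exact Hr. }
  destruct (Hex c) as [u [Hu0 Hu]].
  assert (H1 : c <= u p).
  { apply Hlub; intros r [Hr [v [Hv [Hv0 Hvp]]]].
    apply Rle_trans with (v p); [exact Hvp|].
    apply Hmono; auto.
    rewrite Hv0, Hu0; apply Hub; split; [exact Hr|].
    exists v; auto. }
  assert (H2 : u p <= c).
  { apply Hub; split.
    - destruct (Hex hi) as [v [Hv0 Hv]].
      apply Rle_trans with (v p); [|apply Hhi; assumption].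
      apply Hmono; auto; lra.
    - destruct (Hex (u p)) as [v [Hv0 Hv]].
      exists v; split; [exact Hv|]; split; [exact Hv0|].
      apply Hmono; auto; lra. }
  exists u; split; [exact Hu|]; split; [|lra].
  (* The translate by [p] is a curve with the same value at [0]. *)
  intros t.
  apply (ode_unique F L (fun s => u (s + p)) u 0 HFl); [| exact Hu |].
  - intros s; pose proof (Hu (s + p)) as Hs; rewrite HFp in Hs.
    rewrite <- (Rmult_1_l (F s (u (s + p)))).
    apply (is_derive_comp u (fun s => s + p)); [exact Hs|].
    auto_derive; [trivial | ring].
  - rewrite Rplus_0_l; lra.
Qed.

(** * The integrating factor *)

Lemma mu_pos (a : R -> R) (t : R) : 0 < mu a t.
Proof. apply exp_pos. Qed.

Lemma is_derive_mu (a : R -> R) (t : R) :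
  class_C0 a -> is_derive (mu a) t (mu a t * a t).
Proof.
  intros Ha; unfold mu.
  rewrite Rmult_comm.
  apply (is_derive_comp exp (fun s => RInt a 0 s)).
  - apply is_derive_Reals, derivable_pt_lim_exp.
  - apply is_derive_RInt0, Ha.
Qed.

Lemma class_C0_mu (a : R -> R) : class_C0 a -> class_C0 (mu a).
Proof.
  intros Ha t; apply (ex_derive_continuous (mu a)).
  eexists; apply is_derive_mu, Ha.
Qed.

Lemma mu_periodic (p : R) (a : R -> R) :
  class_C0 a -> periodic p a -> RInt a 0 p = 0 -> periodic p (mu a).
Proof.
  intros Ha Hap Ha0 t; unfold mu.
  rewrite RInt0_periodic_shift, Ha0, Rplus_0_r by assumption; reflexivity.
Qed.

Lemma mu_bounds (p : R) (a : R -> R) :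
  0 < p -> class_C0 a -> periodic p a -> RInt a 0 p = 0 ->
  exists m0 m1, 0 < m0 /\ forall t, m0 <= mu a t <= m1.
Proof.
  intros Hp Ha Hap Ha0.
  destruct (periodic_bounded p (fun t => RInt a 0 t)) as [K [_ HK]].
  - exact Hp.
  - intros t; apply (ex_derive_continuous (fun t => RInt a 0 t)).
    eexists; apply is_derive_RInt0, Ha.
  - intros t; rewrite RInt0_periodic_shift, Ha0 by assumption; ring.
  - exists (exp (- K)), (exp K); split; [apply exp_pos|].
    intros t; specialize (HK t); apply Rabs_le_between in HK.
    split; (apply Rnot_lt_le; intros Hlt; apply exp_lt_inv in Hlt; lra).
Qed.

Lemma RInt_mu_pos (p : R) (a : R -> R) :
  0 < p -> class_C0 a -> 0 < RInt (mu a) 0 p.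
Proof.
  intros Hp Ha; apply RInt_gt_0; [exact Hp | |].
  - intros; apply mu_pos.
  - intros; apply class_C0_mu, Ha.
Qed.

Lemma is_derive_mu_solution (a f g x : R -> R) (t : R) :
  class_C0 a -> is_solution a f g x ->
  is_derive (fun s => mu a s * x s) t (mu a t * (f t - g (x t))).
Proof.
  intros Ha Hx; destruct (Hx t) as [Hd Heq].
  pose proof (is_derive_mu a t Ha) as Hmu.
  apply Derive_correct in Hd.
  pose proof (is_derive_mult _ _ _ _ _ Hmu Hd Rmult_comm) as H.
  evar_last; [exact H|].
  unfold plus, mult; simpl; rewrite <- Heq; ring.
Qed.

Lemma solution_of_mu_form (a f g u : R -> R) :
  class_C0 a ->
  (forall t, is_derive u t (mu a t * (f t - g (u t / mu a t)))) ->
  is_solution a f g (fun t => u t / mu a t).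
Proof.
  intros Ha Hu t.
  pose proof (mu_pos a t).
  assert (H1 : is_derive (fun t => u t / mu a t) t
     ((f t - g (u t / mu a t)) - a t * (u t / mu a t))).
  { evar_last; [apply is_derive_div; [apply Hu | apply is_derive_mu, Ha | lra] |].
    field; lra. }
  split; [eexists; exact H1|].
  rewrite (is_derive_unique (fun t : R => u t / mu a t) t _ H1); ring.
Qed.

(** The increment of [u] over a period is [If - int mu a * k], and the sign
    condition on [k - G] lets [G] replace [k].  The multiplier [e] stands for a
    sign, so that bounds from above and from below come from one statement; [d] is the
    surplus of the sign condition. *)
Lemma period_increment (p : R) (a f k u : R -> R) (e G d t : R) :
  0 <= p -> class_C0 a -> class_C0 f ->
  periodic p (mu a) -> periodic p f ->
  (forall s, is_derive u s (mu a s * (f s - k s))) ->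
  (forall s, t <= s <= t + p -> d <= e * (k s - G)) ->
  e * (u (t + p) - u t) <=
    e * (RInt (fun s => mu a s * f s) 0 p - G * RInt (mu a) 0 p)
    - d * RInt (mu a) 0 p.
Proof.
  intros Hp Ha Hf Hmup Hfp Hu Hk.
  set (If := fun t => RInt (fun s => mu a s * f s) 0 t).
  set (J := fun t => RInt (mu a) 0 t).
  assert (Hmuc := class_C0_mu a Ha).
  assert (Hmuf : class_C0 (fun s => mu a s * f s)) by (apply class_C0_mult; assumption).
  assert (H : e * (If t - G * J t - u t) - d * J t <=
              e * (If (t + p) - G * J (t + p) - u (t + p)) - d * J (t + p)).
  { apply (le_of_derive_nonneg
      (fun s => e * (If s - G * J s - u s) - d * J s)
      (fun s => mu a s * (e * (k s - G) - d))); [lra | |].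
    - intros s _.
      pose proof (is_derive_RInt0 _ s Hmuf) as H1.
      pose proof (is_derive_RInt0 _ s Hmuc) as H2.
      pose proof (Hu s) as H3.
      fold If in H1; fold J in H2.
      auto_derive; [repeat split; eexists; eassumption|].
      rewrite (is_derive_unique (fun x : R => If x) _ _ H1),
        (is_derive_unique (fun x : R => J x) _ _ H2),
        (is_derive_unique (fun x : R => u x) _ _ H3); ring.
    - intros s Hs; specialize (Hk s Hs); pose proof (mu_pos a s).
      apply Rmult_le_pos; lra. }
  assert (HI : If (t + p) = If t + If p).
  { apply RInt0_periodic_shift; [exact Hmuf|].
    intros s; rewrite Hmup, Hfp; reflexivity. }
  assert (HJ : J (t + p) = J t + J p) by (apply RInt0_periodic_shift; assumption).
  rewrite HI, HJ in H; fold (If p); fold (J p).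
  nra.
Qed.

(** * Unboundedness when the mean condition fails *)

Lemma unbounded_of_steady_growth (p D : R) (w : R -> R) :
  0 < p -> 0 < D -> (forall t, 0 <= t -> w t + D <= w (t + p)) ->
  ~ exists M, forall t, 0 <= t -> w t <= M.
Proof.
  intros Hp HD Hinc [M HM].
  assert (Hn : forall n, 0 <= INR n * p /\ w 0 + INR n * D <= w (INR n * p)).
  { induction n as [|n [IH1 IH2]].
    - simpl; rewrite !Rmult_0_l; lra.
    - rewrite S_INR, Rmult_plus_distr_r, Rmult_1_l.
      specialize (Hinc _ IH1); lra. }
  destruct (INR_archimed D (M - w 0) HD) as [n Hgt].
  destruct (Hn n) as [H1 H2]; specialize (HM _ H1); lra.
Qed.

(** Used with [e = -1], [G = gp] and with [e = 1], [G = gm].  On a bounded range of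
    [x] the strict inequality for [g - G] has a positive margin [d], so
    [- e * mu a * x] grows by [d * RInt (mu a) 0 p] in each period.  Read in
    reversed time, [e * mu a * x] grows in the same way, which covers the negative
    half-line. *)
Lemma unbounded_solutions (p : R) (a f g x : R -> R) (e G : R) :
  0 < p -> class_C0 a -> class_C0 f -> class_C0 g ->
  periodic p a -> periodic p f -> RInt a 0 p = 0 ->
  (forall r, 0 < e * (g r - G)) ->
  e * (RInt (fun s => mu a s * f s) 0 p - G * RInt (mu a) 0 p) <= 0 ->
  is_solution a f g x ->
  unbounded_pinfty x /\ unbounded_minfty x.
Proof.
  intros Hp Ha Hf Hg Hap Hfp Ha0 HgG Hmean Hx.
  destruct (mu_bounds p a) as [m0 [m1 [Hm0 Hmu]]]; try assumption.
  pose proof (RInt_mu_pos p a Hp Ha) as HJ.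
  pose proof (mu_periodic p a Ha Hap Ha0) as Hmup.
  assert (Hgap : forall M, exists d, 0 < d /\
            forall r, Rabs r <= M -> d <= e * (g r - G)).
  { intros M; destruct (Rle_or_lt 0 M) as [HM|HM].
    - destruct (continuous_attains_max (fun r => - (e * (g r - G))) (- M) M)
        as [q [_ Hq]]; [lra | |].
      + apply class_C0_opp, (class_C0_mult (fun _ => e)).
        * intros r; apply continuous_const.
        * intros r; apply (continuous_minus g); [apply Hg | apply continuous_const].
      + exists (e * (g q - G)); split; [apply HgG|].
        intros r Hr; apply Rabs_le_between in Hr; specialize (Hq r Hr); lra.
    - exists 1; split; [lra|].
      intros r Hr; pose proof (Rabs_pos r); lra. }
  assert (Hinc : forall d t, (forall s, t <= s <= t + p -> d <= e * (g (x s) - G)) ->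
            e * (mu a (t + p) * x (t + p) - mu a t * x t) <= - (d * RInt (mu a) 0 p)).
  { intros d t Hk.
    pose proof (period_increment p a f (fun s => g (x s)) (fun s => mu a s * x s)
      e G d t (Rlt_le _ _ Hp) Ha Hf Hmup Hfp
      (fun s => is_derive_mu_solution a f g x s Ha Hx) Hk).
    simpl in *; lra. }
  assert (Hb : forall M s, Rabs (x s) <= M ->
            Rabs (e * (mu a s * x s)) <= Rabs e * (m1 * M)).
  { intros M s Hs; rewrite !Rabs_mult, (Rabs_pos_eq (mu a s))
      by (apply Rlt_le, mu_pos).
    apply Rmult_le_compat_l; [apply Rabs_pos|].
    apply Rmult_le_compat; try apply Hmu; try assumption; try apply Rabs_pos.
    apply Rlt_le, mu_pos. }
  split; intros [M HM]; destruct (Hgap M) as [d [Hd Hgd]].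
  - apply (unbounded_of_steady_growth p (d * RInt (mu a) 0 p)
      (fun t => - (e * (mu a t * x t))) Hp).
    + apply Rmult_lt_0_compat; assumption.
    + intros t Ht; specialize (Hinc d t).
      assert (H := Hinc (fun s Hs => Hgd _ (HM s (Rle_trans _ _ _ Ht (proj1 Hs))))).
      lra.
    + exists (Rabs e * (m1 * M)); intros t Ht.
      eapply Rle_trans; [apply Rle_abs|]; rewrite Rabs_Ropp; apply Hb, HM, Ht.
  - apply (unbounded_of_steady_growth p (d * RInt (mu a) 0 p)
      (fun t => e * (mu a (- t) * x (- t))) Hp).
    + apply Rmult_lt_0_compat; assumption.
    + intros t Ht; specialize (Hinc d (- (t + p))).
      replace (- (t + p) + p) with (- t) in Hinc by ring.
      assert (H : forall s, - (t + p) <= s <= - t -> d <= e * (g (x s) - G))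
        by (intros s Hs; apply Hgd, HM; lra).
      specialize (Hinc H); lra.
    + exists (Rabs e * (m1 * M)); intros t Ht.
      eapply Rle_trans; [apply Rle_abs|]; apply Hb, HM; lra.
Qed.

(** * Existence of a periodic solution *)

Definition clamp (N x : R) : R := Rmax (- N) (Rmin N x).

Lemma clamp_bounds (N x : R) : 0 <= N -> - N <= clamp N x <= N.
Proof.
  intros HN; unfold clamp; split; [apply Rmax_l|].
  apply Rmax_lub; [lra | apply Rmin_l].
Qed.

Lemma clamp_id (N x : R) : - N <= x <= N -> clamp N x = x.
Proof.
  intros Hx; unfold clamp; rewrite Rmin_right by lra; apply Rmax_right; lra.
Qed.

Lemma clamp_lipschitz (N x y : R) : Rabs (clamp N x - clamp N y) <= Rabs (x - y).
Proof.
  unfold clamp, Rmax, Rmin, Rabs.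
  repeat destruct Rle_dec; repeat destruct Rcase_abs; lra.
Qed.

Lemma clamp_lipschitz_comp (g : R -> R) (N : R) :
  0 <= N -> class_C1 g ->
  exists L, 0 < L /\
    forall x y, Rabs (g (clamp N x) - g (clamp N y)) <= L * Rabs (x - y).
Proof.
  intros HN [Hg1 Hg2].
  destruct (continuous_bounded_segment (Derive g) (- N) N) as [L [HL HLb]];
    [lra | exact Hg2 |].
  exists L; split; [exact HL|]; intros x y.
  destruct (MVT_gen g (clamp N y) (clamp N x) (Derive g)) as [r [Hr Heq]].
  - intros r _; apply Derive_correct, Hg1.
  - intros r _; apply continuity_pt_filterlim, (ex_derive_continuous g), Hg1.
  - rewrite Heq, Rabs_mult.
    apply Rmult_le_compat; try apply Rabs_pos; [|apply clamp_lipschitz].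
    apply HLb.
    pose proof (clamp_bounds N x HN); pose proof (clamp_bounds N y HN).
    split; [eapply Rle_trans; [|apply Hr]; apply Rmin_glb
           |eapply Rle_trans; [apply Hr|]; apply Rmax_lub]; lra.
Qed.

Lemma deviation_bound (u u' : R -> R) (B t : R) :
  0 <= t -> (forall s, is_derive u s (u' s)) -> (forall s, Rabs (u' s) <= B) ->
  Rabs (u t - u 0) <= B * t.
Proof.
  intros Ht Hu HB.
  destruct (MVT_gen u 0 t u') as [r [_ Heq]].
  - intros r _; apply Hu.
  - intros r _; apply continuity_pt_filterlim, (ex_derive_continuous u).
    eexists; apply Hu.
  - rewrite Heq, Rabs_mult, Rminus_0_r, (Rabs_pos_eq t Ht).
    apply Rmult_le_compat_r; [exact Ht | apply HB].
Qed.

(** The period map is applied to the equation for [u] with [g] replaced by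
    [g] composed with [clamp N].  This equation is globally Lipschitz in [u]
    because the factors [mu a] and [/ mu a] cancel.  Its right-hand side has a
    bound [B] that does not depend on [N], which avoids a circular choice: [B]
    fixes the interval of initial values, that interval fixes [N]. *)
Lemma exists_periodic_solution (p : R) (a f g : R -> R) (c X G : R) :
  0 < p -> class_C0 a -> class_C0 f -> class_C1 g ->
  periodic p a -> periodic p f -> RInt a 0 p = 0 ->
  RInt (fun s => mu a s * f s) 0 p = c * RInt (mu a) 0 p ->
  0 <= X -> (forall r, X <= r -> c <= g r) -> (forall r, r <= - X -> g r <= c) ->
  (forall r, Rabs (g r) <= G) ->
  exists y, is_periodic_solution p a f g y.
Proof.
  intros Hp Ha Hf Hg Hap Hfp Ha0 Hc HX HXp HXm HG.
  destruct (mu_bounds p a) as [m0 [m1 [Hm0 Hmu]]]; try assumption.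
  destruct (periodic_bounded p f Hp Hf Hfp) as [Mf [HMf HMfb]].
  pose proof (mu_periodic p a Ha Hap Ha0) as Hmup.
  assert (HG0 : 0 <= G) by (eapply Rle_trans; [apply Rabs_pos | apply (HG 0)]).
  assert (Hm1 : 0 < m1) by (pose proof (Hmu 0); lra).
  set (B := m1 * (Mf + G)).
  assert (HB : 0 <= B) by (apply Rmult_le_pos; lra).
  (* Starting at [R0] and losing at most [B p], an orbit keeps [u >= X m1], that
     is [u / mu >= X], during one period. *)
  set (R0 := X * m1 + B * p).
  assert (HR0 : 0 <= R0)
    by (apply Rplus_le_le_0_compat; apply Rmult_le_pos; lra).
  (* Orbits that start in [- R0, R0] keep [|u / mu| <= N] during one period. *)
  set (N := (R0 + B * p) / m0).
  assert (HNm0 : N * m0 = R0 + B * p) by (unfold N; field; lra).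
  assert (HBp : 0 <= B * p) by (apply Rmult_le_pos; lra).
  assert (HXN : X <= N).
  { apply Rmult_le_reg_r with m0; [exact Hm0|]; rewrite HNm0; unfold R0.
    pose proof (Hmu 0); nra. }
  destruct (clamp_lipschitz_comp g N) as [L [HL HLg]]; [lra | exact Hg |].
  set (F := fun t u => mu a t * (f t - g (clamp N (u / mu a t)))).
  assert (HFb : forall t x, Rabs (F t x) <= B).
  { intros t x; unfold F; rewrite Rabs_mult, (Rabs_pos_eq (mu a t))
      by (apply Rlt_le, mu_pos).
    apply Rmult_le_compat; [apply Rlt_le, mu_pos | apply Rabs_pos | apply Hmu |].
    eapply Rle_trans; [apply Rabs_triang|]; rewrite Rabs_Ropp.
    apply Rplus_le_compat; [apply HMfb | apply HG]. }
  assert (HFl : forall t x y, Rabs (F t x - F t y) <= L * Rabs (x - y)).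
  { intros t x y; unfold F; pose proof (mu_pos a t) as Hpos.
    rewrite <- Rmult_minus_distr_l, Rabs_mult, (Rabs_pos_eq (mu a t)) by lra.
    replace (f t - g (clamp N (x / mu a t)) - (f t - g (clamp N (y / mu a t))))
      with (- (g (clamp N (x / mu a t)) - g (clamp N (y / mu a t)))) by ring.
    rewrite Rabs_Ropp.
    eapply Rle_trans; [apply Rmult_le_compat_l; [lra | apply HLg]|].
    replace (x / mu a t - y / mu a t) with ((x - y) / mu a t) by (field; lra).
    unfold Rdiv; rewrite Rabs_mult, (Rabs_pos_eq (/ mu a t))
      by (apply Rlt_le, Rinv_0_lt_compat, Hpos).
    apply Req_le; field; lra. }
  assert (HFc : forall u, class_C0 u -> class_C0 (fun s => F s (u s))).
  { intros u Hu; apply class_C0_mult; [apply class_C0_mu, Ha|].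
    intros t; apply (continuous_minus f); [apply Hf|].
    apply (continuous_comp (fun s => u s / mu a s) (fun r => g (clamp N r))).
    - apply (continuous_mult u (fun s => / mu a s)); [apply Hu|].
      apply continuous_Rinv_comp; [apply class_C0_mu, Ha |].
      pose proof (mu_pos a t); lra.
    - apply (continuous_of_lipschitz (fun r => g (clamp N r)) L).
      intros s r; apply HLg. }
  assert (Hinc : forall u e, integral_curve F u ->
     (forall s, 0 <= s <= p -> 0 <= e * (g (clamp N (u s / mu a s)) - c)) ->
     e * (u p - u 0) <= 0).
  { intros u e Hu Hsgn.
    pose proof (period_increment p a f (fun s => g (clamp N (u s / mu a s))) u
      e c 0 0 (Rlt_le _ _ Hp) Ha Hf Hmup Hfp Hu) as H.
    rewrite Rplus_0_l, Hc in H; specialize (H Hsgn); lra. }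
  assert (Hdev : forall u, integral_curve F u ->
     forall s, 0 <= s <= p -> - (B * p) <= u s - u 0 <= B * p).
  { intros u Hu s Hs; apply Rabs_le_between.
    eapply Rle_trans;
      [apply (deviation_bound u (fun t => F t (u t)) B); [lra | exact Hu | intros; apply HFb]|].
    apply Rmult_le_compat_l; lra. }
  destruct (periodic_orbit F L B p (- R0) R0) as [u [Hu [Hup Hu0]]];
    try assumption; try lra.
  - intros t x; unfold F; rewrite Hmup, Hfp; reflexivity.
  - intros u Hu Hu0.
    assert (H : -1 * (u p - u 0) <= 0); [|lra].
    apply Hinc; [exact Hu|]; intros s Hs.
    specialize (Hdev u Hu s Hs); unfold R0 in Hu0.
    assert (Hle : u s / mu a s <= - X).
    { apply Rmult_le_reg_r with (mu a s); [apply mu_pos|].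
      replace (u s / mu a s * mu a s) with (u s)
        by (field; pose proof (mu_pos a s); lra).
      pose proof (Hmu s); nra. }
    assert (g (clamp N (u s / mu a s)) <= c); [|lra].
    apply HXm; unfold clamp; apply Rmax_lub; [lra|].
    eapply Rle_trans; [apply Rmin_r | exact Hle].
  - intros u Hu Hu0.
    assert (H : 1 * (u p - u 0) <= 0); [|lra].
    apply Hinc; [exact Hu|]; intros s Hs.
    specialize (Hdev u Hu s Hs); unfold R0 in Hu0.
    assert (Hle : X <= u s / mu a s).
    { apply Rmult_le_reg_r with (mu a s); [apply mu_pos|].
      replace (u s / mu a s * mu a s) with (u s)
        by (field; pose proof (mu_pos a s); lra).
      pose proof (Hmu s); nra. }
    assert (c <= g (clamp N (u s / mu a s))); [|lra].
    apply HXp; unfold clamp; eapply Rle_trans; [|apply Rmax_r].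
    apply Rmin_glb; assumption.
  - assert (Hper : periodic p (fun t => u t / mu a t))
      by (intros t; rewrite Hup, Hmup; reflexivity).
    exists (fun t => u t / mu a t); split; [|exact Hper].
    apply solution_of_mu_form; [exact Ha|]; intros t.
    rewrite <- (clamp_id N (u t / mu a t)); [apply Hu|].
    destruct (periodic_reduce p t Hp) as [k [s [Hs ->]]].
    rewrite (periodic_IZR p (fun t => u t / mu a t)) by exact Hper.
    specialize (Hdev u Hu s Hs); pose proof (mu_pos a s) as Hpos.
    pose proof (Hmu s) as Hms.
    assert (HN : 0 <= N) by lra.
    split; apply Rmult_le_reg_r with (mu a s); try exact Hpos;
      replace (u s / mu a s * mu a s) with (u s) by (field; lra); nra.
Qed.

(** * Attraction *)

Lemma increment_of_derive_ge (g : R -> R) (M m x y : R) :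
  (forall r, ex_derive g r) ->
  (forall r, Rabs r <= M -> m <= Derive g r) ->
  Rabs x <= M -> Rabs y <= M ->
  m * (x - y) ^ 2 <= (g x - g y) * (x - y).
Proof.
  intros Hg Hm Hx Hy.
  destruct (MVT_gen g y x (Derive g)) as [r [Hr Heq]].
  - intros r _; apply Derive_correct, Hg.
  - intros r _; apply continuity_pt_filterlim, (ex_derive_continuous g), Hg.
  - assert (Hrm : m <= Derive g r).
    { apply Hm; apply Rabs_le_between in Hx; apply Rabs_le_between in Hy.
      apply Rabs_le; split;
        [eapply Rle_trans; [|apply Hr]; apply Rmin_glb
        |eapply Rle_trans; [apply Hr|]; apply Rmax_lub]; lra. }
    rewrite Heq; pose proof (pow2_ge_0 (x - y)); nra.
Qed.

(** For [w = mu a * (x - y)] the linear terms cancel and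
    [w w' = - mu a ^ 2 (g x - g y)(x - y) <= - m w ^ 2], so
    [w ^ 2 exp (2 m t)] decreases. *)
Lemma difference_decay (a f g x y : R -> R) (m t : R) :
  class_C0 a -> is_solution a f g x -> is_solution a f g y -> 0 <= t ->
  (forall s, 0 <= s <= t -> m * (x s - y s) ^ 2 <= (g (x s) - g (y s)) * (x s - y s)) ->
  Rabs (mu a t * (x t - y t)) <= Rabs (mu a 0 * (x 0 - y 0)) * exp (- m * t).
Proof.
  intros Ha Hx Hy Ht Hm.
  set (w := fun s => mu a s * x s - mu a s * y s).
  assert (Hw : forall s, is_derive w s (mu a s * (g (y s) - g (x s)))).
  { intros s; evar_last;
      [apply (is_derive_minus (fun s => mu a s * x s) (fun s => mu a s * y s));
        apply is_derive_mu_solution; eassumption |].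
    unfold minus, plus, opp; simpl; ring. }
  assert (Hwe : forall s, mu a s * (x s - y s) = w s) by (intros; unfold w; ring).
  rewrite !Hwe.
  assert (H : - (w 0 ^ 2 * exp (2 * m * 0)) <= - (w t ^ 2 * exp (2 * m * t))).
  { apply (le_of_derive_nonneg (fun s => - (w s ^ 2 * exp (2 * m * s)))
      (fun s => 2 * exp (2 * m * s) * (mu a s ^ 2 *
        ((g (x s) - g (y s)) * (x s - y s) - m * (x s - y s) ^ 2))) 0 t Ht).
    - intros s _; pose proof (Hw s) as Hws.
      auto_derive; [repeat split; eexists; exact Hws|].
      rewrite (is_derive_unique (fun x : R => w x) _ _ Hws), <- Hwe; ring.
    - intros s Hs; specialize (Hm s Hs).
      pose proof (exp_pos (2 * m * s)); pose proof (pow2_ge_0 (mu a s)).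
      apply Rmult_le_pos; [lra|]; apply Rmult_le_pos; lra. }
  rewrite Rmult_0_r, exp_0, Rmult_1_r in H.
  assert (He : exp (2 * m * t) * (exp (- m * t)) ^ 2 = 1).
  { simpl; rewrite Rmult_1_r, <- !exp_plus, <- exp_0; f_equal; ring. }
  apply Rsqr_incr_0_var.
  - rewrite Rsqr_mult, <- !Rsqr_abs, !Rsqr_pow2.
    pose proof (pow2_ge_0 (exp (- m * t))).
    replace (w t ^ 2) with (w t ^ 2 * exp (2 * m * t) * exp (- m * t) ^ 2)
      by (rewrite Rmult_assoc, He; ring).
    apply Rmult_le_compat_r; lra.
  - apply Rmult_le_pos; [apply Rabs_pos | apply Rlt_le, exp_pos].
Qed.

Lemma is_lim_0_of_exp_decay (h : R -> R) (K m : R) :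
  0 < m -> (forall t, 0 <= t -> Rabs (h t) <= K * exp (- m * t)) ->
  is_lim h p_infty 0.
Proof.
  intros Hm Hh.
  assert (HK : 0 <= K).
  { specialize (Hh 0 (Rle_refl 0)); rewrite Rmult_0_r, exp_0 in Hh.
    pose proof (Rabs_pos (h 0)); lra. }
  apply is_lim_spec; intros [eps Heps]; simpl.
  assert (HT : 0 <= K / (m * eps)).
  { apply Rmult_le_pos; [exact HK|]; apply Rlt_le, Rinv_0_lt_compat; nra. }
  exists (K / (m * eps)); intros t Ht.
  rewrite Rminus_0_r; eapply Rle_lt_trans; [apply Hh; lra|].
  assert (Hmt : K < m * t * eps).
  { apply Rmult_lt_compat_r with (r := m * eps) in Ht; [|nra].
    replace (K / (m * eps) * (m * eps)) with K in Ht by (field; lra). lra. }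
  replace (- m * t) with (- (m * t)) by ring; rewrite exp_Ropp.
  pose proof (exp_ineq1_le (m * t)); pose proof (exp_pos (m * t)).
  apply Rmult_lt_reg_r with (exp (m * t)); [assumption|].
  replace (K * / exp (m * t) * exp (m * t)) with K by (field; lra).
  nra.
Qed.

(** The decay estimate is used twice: with [m = 0], where monotonicity of [g]
    suffices, to confine [x] and [y] to a bounded range; then with the
    minimum of [g'] on that range, which is positive. *)
Lemma periodic_solution_attracts (p : R) (a f g x y : R -> R) :
  0 < p -> class_C0 a -> class_C1 g -> periodic p a -> RInt a 0 p = 0 ->
  (forall r, 0 < Derive g r) ->
  is_periodic_solution p a f g y -> is_solution a f g x -> attracts y x.
Proof.
  intros Hp Ha [Hg1 Hg2] Hap Ha0 Hgpos [Hy Hyp] Hx.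
  destruct (mu_bounds p a) as [m0 [m1 [Hm0 Hmu]]]; try assumption.
  assert (Hyc : class_C0 y)
    by (intros t; apply (ex_derive_continuous y), Hy).
  destruct (periodic_bounded p y Hp Hyc Hyp) as [My [HMy HMyb]].
  set (W0 := Rabs (mu a 0 * (x 0 - y 0))).
  assert (Hdiff : forall t, Rabs (x t - y t) <= Rabs (mu a t * (x t - y t)) / m0).
  { intros t; apply Rmult_le_reg_r with m0; [exact Hm0|].
    unfold Rdiv; rewrite Rmult_assoc, Rinv_l, Rmult_1_r by lra.
    rewrite Rabs_mult, (Rabs_pos_eq (mu a t)) by (apply Rlt_le, mu_pos).
    rewrite Rmult_comm; apply Rmult_le_compat_r; [apply Rabs_pos | apply Hmu]. }
  assert (Hi0 : 0 < / m0) by (apply Rinv_0_lt_compat, Hm0).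
  assert (Hrate : forall m, (forall s, 0 <= s ->
       m * (x s - y s) ^ 2 <= (g (x s) - g (y s)) * (x s - y s)) ->
     forall t, 0 <= t -> Rabs (x t - y t) <= W0 / m0 * exp (- m * t)).
  { intros m Hm t Ht; eapply Rle_trans; [apply Hdiff|].
    unfold Rdiv; rewrite (Rmult_comm W0), Rmult_assoc, Rmult_comm.
    apply Rmult_le_compat_l; [lra|].
    apply (difference_decay a f g x y m t); try assumption.
    intros s Hs; apply Hm; lra. }
  set (M := My + W0 / m0).
  assert (HM : forall t, 0 <= t -> Rabs (x t) <= M /\ Rabs (y t) <= M).
  { intros t Ht.
    assert (H : Rabs (x t - y t) <= W0 / m0).
    { replace (W0 / m0) with (W0 / m0 * exp (- 0 * t))
        by (rewrite Ropp_0, Rmult_0_l, exp_0; ring).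
      apply Hrate; [|exact Ht]; intros s _.
      apply increment_of_derive_ge with (Rmax (Rabs (x s)) (Rabs (y s)));
        [exact Hg1 | | apply Rmax_l | apply Rmax_r].
      intros r _; apply Rlt_le, Hgpos. }
    pose proof (HMyb t); pose proof (Rabs_pos (x t - y t)).
    pose proof (Rabs_triang (x t - y t) (y t)) as Htr.
    replace (x t - y t + y t) with (x t) in Htr by ring.
    unfold M; lra. }
  destruct (continuous_attains_max (fun r => - Derive g r) (- M) M) as [q [_ Hq]].
  - pose proof (HM 0 (Rle_refl 0)); pose proof (Rabs_pos (x 0)); lra.
  - apply class_C0_opp, Hg2.
  - apply is_lim_0_of_exp_decay with (W0 / m0) (Derive g q); [apply Hgpos|].
    apply Hrate; intros s Hs.
    apply increment_of_derive_ge with M; [exact Hg1 | | apply HM, Hs | apply HM, Hs].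
    intros r Hr; apply Rabs_le_between in Hr; specialize (Hq r Hr); lra.
Qed.

Lemma periodic_eq_of_attracts (p : R) (y z : R -> R) :
  0 < p -> periodic p y -> periodic p z -> attracts y z -> forall t, z t = y t.
Proof.
  intros Hp Hy Hz Hlim t.
  destruct (Req_dec (z t - y t) 0) as [H|H]; [lra|exfalso].
  apply is_lim_spec in Hlim.
  destruct (Hlim (mkposreal _ (Rabs_pos_lt _ H))) as [T HT]; simpl in HT.
  destruct (INR_archimed p (T - t) Hp) as [n Hn].
  specialize (HT (t + INR n * p) ltac:(lra)).
  rewrite INR_IZR_INZ, !periodic_IZR, Rminus_0_r in HT by assumption; lra.
Qed.

(** * Solvability, attraction and unboundedness *)

Theorem theorem3p1 (p : R) (a f g : R -> R) (gm gp : R)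
  (hp : 0 < p)
  (ha : class_C0 a) (hf : class_C0 f)
  (hap : periodic p a) (hfp : periodic p f)
  (hg : class_C1 g)
  (ha0 : RInt a 0 p = 0)
  (hgp : is_lim g p_infty gp) (hgm : is_lim g m_infty gm)
  (hgb : forall x : R, gm < g x /\ g x < gp) :
  ((exists y : R -> R, is_periodic_solution p a f g y) <->
     solvability_condition p a f gm gp) /\
  (solvability_condition p a f gm gp ->
   (forall x : R, 0 < Derive g x) ->
   exists y : R -> R,
     is_periodic_solution p a f g y /\
     (forall z : R -> R, is_periodic_solution p a f g z ->
        forall t : R, z t = y t) /\
     (forall x : R -> R, is_solution a f g x -> attracts y x)) /\
  (~ solvability_condition p a f gm gp ->
   forall x : R -> R, is_solution a f g x ->
     unbounded_pinfty x /\ unbounded_minfty x).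
Proof.
  assert (Hunb : ~ solvability_condition p a f gm gp ->
     forall x, is_solution a f g x -> unbounded_pinfty x /\ unbounded_minfty x).
  { intros Hnot x Hx; unfold solvability_condition in Hnot.
    assert (hgc : class_C0 g) by (intros r; apply (ex_derive_continuous g), hg).
    destruct (Rlt_or_le (gm * RInt (mu a) 0 p) (RInt (fun t => mu a t * f t) 0 p))
      as [H1|H1].
    - destruct (Rlt_or_le (RInt (fun t => mu a t * f t) 0 p) (gp * RInt (mu a) 0 p))
        as [H2|H2]; [tauto|].
      apply (unbounded_solutions p a f g x (-1) gp); try assumption; [|lra].
      intros r; pose proof (hgb r); lra.
    - apply (unbounded_solutions p a f g x 1 gm); try assumption; [|lra].
      intros r; pose proof (hgb r); lra. }
  assert (Hex : solvability_condition p a f gm gp ->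
     exists y, is_periodic_solution p a f g y).
  { intros [H1 H2].
    pose proof (RInt_mu_pos p a hp ha) as HJ.
    assert (Hdiv : forall r s : R, 0 < s -> r = r / s * s) by (intros; field; lra).
    set (c := RInt (fun t => mu a t * f t) 0 p / RInt (mu a) 0 p).
    assert (Hc : RInt (fun t => mu a t * f t) 0 p = c * RInt (mu a) 0 p)
      by (apply Hdiv, HJ).
    rewrite Hc in H1, H2.
    apply Rmult_lt_reg_r in H1; [|exact HJ].
    apply Rmult_lt_reg_r in H2; [|exact HJ].
    apply is_lim_spec in hgp; apply is_lim_spec in hgm.
    destruct (hgp (mkposreal (gp - c) ltac:(lra))) as [Xp HXp].
    destruct (hgm (mkposreal (c - gm) ltac:(lra))) as [Xm HXm].
    simpl in HXp, HXm.
    pose proof (Rle_abs Xp); pose proof (Rabs_pos Xp).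
    pose proof (Rabs_maj2 Xm); pose proof (Rabs_pos Xm).
    apply (exists_periodic_solution p a f g c (Rabs Xp + Rabs Xm + 1)
             (Rabs gm + Rabs gp)); try assumption; try lra.
    - intros r Hr; specialize (HXp r ltac:(lra)); apply Rabs_def2 in HXp; lra.
    - intros r Hr; specialize (HXm r ltac:(lra)); apply Rabs_def2 in HXm; lra.
    - intros r; pose proof (hgb r).
      pose proof (Rle_abs gp); pose proof (Rabs_maj2 gm).
      pose proof (Rabs_pos gp); pose proof (Rabs_pos gm).
      apply Rabs_le; lra. }
  split; [split; [|exact Hex] | split; [|exact Hunb]].
  - intros [y [Hy Hyp]].
    apply Classical_Prop.NNPP; intros Hnot.
    destruct (Hunb Hnot y Hy) as [Hinf _]; apply Hinf.
    destruct (periodic_bounded p y hp) as [M [_ HM]].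
    + intros t; apply (ex_derive_continuous y), Hy.
    + exact Hyp.
    + exists M; intros t _; apply HM.
  - intros Hsolv Hgpos; destruct (Hex Hsolv) as [y Hy].
    assert (Hatt : forall x, is_solution a f g x -> attracts y x)
      by (intros x Hx; apply (periodic_solution_attracts p a f g x y); assumption).
    exists y; split; [exact Hy|]; split; [|exact Hatt].
    intros z [Hz Hzp]; apply (periodic_eq_of_attracts p); try assumption.
    + apply Hy.
    + apply Hatt, Hz.
Qed.
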